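(* Let $G$ be a graph. Then there exists a one-to-one correspondence between the set of all travel groupoids on $G$ and the set of all T-partition systems on $G$.
   Context: Graphs are undirected, possibly infinite, with no loops and no multiple edges; write $G=(V,E)$. A travel groupoid is a set $V\neq\emptyset$ with binary operation $*$ satisfying (t1) $(u*v)*u=u$ for all $u,v$, and (t2) if $(u*v)*v=u$ then $u=v$. A travel groupoid $(V,* )$ is on $G$ if $V(G)=V$ and $E(G)=\{\{u,v\}\mid u\neq v,\ u*v=v\}$. For $u\in V$, $N_G[u]=\{u\}\cup\{v\mid \{u,v\}\in E\}$. A T-partition system on $G$ is a family $(V_{u,v}\subseteq V\mid (u,v)\in V\times V)$ such that: (P0) for every $u$, $\{V_{u,v}\mid v\in N_G[u]\}$ is a partition of $V$; (P1a) $V_{u,u}=\{u\}$; (P1b) for $u\neq v$: $v\in V_{u,v}$ iff $\{u,v\}\in E$; (P1c) for $u\neq v$: $V_{u,v}=\emptyset$ iff $\{u,v\}\notin E$; (P2) for $u\neq v$: $V_{u,v}\cap V_{v,u}=\emptyset$. *)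

(* Defs.v *)
From mathcomp Require Import all_boot.
From mathcomp Require Import boolp classical_sets functions.

Set Implicit Arguments.
Unset Strict Implicit.
Unset Printing Implicit Defensive.

Local Open Scope classical_set_scope.

(* Edges are unordered pairs, i.e., two-element subsets of V: this excludes
   loops and multiple edges. V may be infinite. *)
Record graph (V : Type) := Graph {
  edges :> set (set V);
  edgesP : forall e, edges e -> exists u v, u <> v /\ e = [set u; v]
}.

Definition closed_neighborhood (V : Type) (G : graph V) (u : V) : set V :=
  [set u] `|` [set v | edges G [set u; v]].

Record travel_groupoid (V : Type) (op : V -> V -> V) : Prop := TravelGroupoid {
  travel_neq0 : [set: V] !=set0;
  travel_t1 : forall u v, op (op u v) u = u;
  travel_t2 : forall u v, op (op u v) v = u -> u = v
}.

Definition travel_groupoid_on (V : Type) (G : graph V) (op : V -> V -> V) :=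
  travel_groupoid op /\
  edges G = [set e | exists u v, [/\ u <> v, op u v = v & e = [set u; v]]].

(* In T_P0 the partition is that of the family indexed by the closed
   neighborhood: distinct indices must carry disjoint (hence distinct)
   blocks. *)
Record T_partition_system (V : Type) (G : graph V) (F : V -> V -> set V) :
    Prop := TPartitionSystem {
  T_P0 : forall u, partition (closed_neighborhood G u) (F u) [set: V];
  T_P1a : forall u, F u u = [set u];
  T_P1b : forall u v, u <> v -> (F u v v <-> edges G [set u; v]);
  T_P1c : forall u v, u <> v -> (F u v = set0 <-> ~ edges G [set u; v]);
  T_P2 : forall u v, u <> v -> F u v `&` F v u = set0
}.

(* Main.v *)
Require Import Defs.
From mathcomp Require Import all_boot.
From mathcomp Require Import boolp classical_sets functions.

Local Open Scope classical_set_scope.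

(** A travel groupoid corresponds to the family [F u v = {w | u * w = v}] of
    fibres of its left translations; conversely, each [w] lies in exactly one
    block [F u v], and [u * w] is its index [v]. Under this dictionary (t1) says
    that nonempty blocks are indexed by neighbours, and (t2) is (P2). *)

Definition fibers {V : Type} (op : V -> V -> V) (u v : V) : set V :=
  [set w | op u w = v].

Lemma fibers_inj (V : Type) : injective (@fibers V).
Proof.
move=> op op' eqF; apply/funext => u; apply/funext => w.
have : fibers op u (op u w) w by [].
by rewrite eqF => /= ->.
Qed.

Section TravelGroupoidTheory.
Context {V : Type} {op : V -> V -> V} (tg : travel_groupoid op).

Lemma travel_idem u : op u u = u.
Proof.
by apply: (travel_t2 tg); rewrite (travel_t1 tg).
Qed.

Lemma travel_fixed u w : op u w = u -> w = u.
Proof. by move=> e; apply/esym/(travel_t2 tg); rewrite e. Qed.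

(** (t1) at [op u w] and [u], where the inner product collapses to [u] by (t1) again. Hence the
    index of a nonempty fibre is [u] itself or a neighbour of [u]. *)
Lemma travel_step u w : op u (op u w) = op u w.
Proof. by have := travel_t1 tg (op u w) u; rewrite (travel_t1 tg u). Qed.

Lemma travel_sym u v : op u v = v -> op v u = u.
Proof. by move=> e; have := travel_t1 tg u v; rewrite e. Qed.

End TravelGroupoidTheory.

Lemma set2_inj {V : Type} {a b c d : V} :
  [set a; b] = [set c; d] -> (a = c /\ b = d) \/ (a = d /\ b = c).
Proof.
move=> e.
have ha : [set c; d] a by rewrite -e; left.
have hb : [set c; d] b by rewrite -e; right.
have hc : [set a; b] c by rewrite e; left.
have hd : [set a; b] d by rewrite e; right.
case: ha => /= ?; case: hb => /= ?; case: hc => /= ?; case: hd => /= ?;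
  subst; by [left | right].
Qed.

(** An unordered pair may be witnessed in the reverse orientation; [travel_sym] turns that case into
    the direct one. *)
Lemma travel_edgeP {V : Type} {G : graph V} {op} :
  travel_groupoid_on G op ->
  forall u v, u <> v -> (op u v = v <-> edges G [set u; v]).
Proof.
move=> [tg EG] u v uv; rewrite EG /=; split=> [e|[a [b [ab e]]]].
  by exists u, v.
by case/set2_inj=> -[-> ->] //; exact: (travel_sym tg).
Qed.

Lemma fibers_T_partition {V : Type} {G : graph V} {op} :
  travel_groupoid_on G op -> T_partition_system G (fibers op).
Proof.
move=> tgG; have [tg _] := tgG; have edgeP := travel_edgeP tgG.
split.
- move=> u; split.
  + apply/seteqP; split=> // w _; exists (op u w) => //.
    have [->|ne] := pselect (op u w = u); first by left.
    by right; apply/edgeP; [exact/nesym | exact: (travel_step tg)].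
  + by move=> v v' _ _ [w [<- <-]].
  + move=> v [->|uv]; first by exists u; exact: (travel_idem tg).
    have [->|ne] := pselect (v = u); first by exists u; exact: (travel_idem tg).
    by exists v; apply/edgeP => //; exact/nesym.
- move=> u; apply/seteqP; split=> w /=; first exact: (travel_fixed tg).
  by move=> ->; exact: (travel_idem tg).
- exact: edgeP.
- move=> u v uv; split=> [F0 /(edgeP _ _ uv) e|ne].
    by have : fibers op u v v by []; rewrite F0.
  apply/seteqP; split=> w //= e; apply: ne; apply/edgeP => //.
  by rewrite -e (travel_step tg).
(* (P2): a common point [w] gives [op (op u w) w = u], so [u = w] by (t2), and then
   [v = op u u = u]. *)
- move=> u v uv; apply/seteqP; split=> w //= -[/= e1 e2]; apply: uv.
  have uw : u = w by apply: (travel_t2 tg); rewrite e1.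
  by rewrite -e1 -uw (travel_idem tg).
Qed.

Section TPartitionTheory.
Context {V : Type} {G : graph V} {F : V -> V -> set V}.
Context (TF : T_partition_system G F).

Lemma T_block_neighbor u v w : F u v w -> u <> v -> edges G [set u; v].
Proof.
move=> Fw uv; apply: contrapT => /(T_P1c TF uv) F0.
by rewrite F0 in Fw.
Qed.

Lemma T_block_exists u w : exists v, F u v w.
Proof.
have [cov _ _] := T_P0 TF u.
by have : [set: V] w by []; rewrite -cov => -[v _ Fw]; exists v.
Qed.

(** (P0) separates only blocks indexed by the closed neighbourhood; by (P1c) a block containing [w]
    has its index there. *)
Lemma T_block_unique u v v' w : F u v w -> F u v' w -> v = v'.
Proof.
have [_ triv _] := T_P0 TF u.
have nbr x : F u x w -> closed_neighborhood G u x.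
  move=> Fx; have [<-|ne] := pselect (u = x); first by left.
  by right; exact: (T_block_neighbor _ _ _ Fx).
by move=> Fv Fv'; apply: triv; [exact: nbr | exact: nbr | exists w].
Qed.

Lemma T_partition_fibers : exists op, fibers op = F.
Proof.
(* Choice over pairs sends [(u, w)] to the index of a block of [u] containing [w]; uniqueness of
   that index makes the fibre the whole block. *)
have [op opP] := choice (fun uw => T_block_exists uw.1 uw.2).
exists (fun u w => op (u, w)).
apply/funext => u; apply/funext => v; apply/seteqP.
split=> w /=; first by move=> <-; exact: (opP (u, w)).
exact: T_block_unique (opP (u, w)).
Qed.

End TPartitionTheory.

(** Nonemptiness is assumed separately: an empty [V] carries a vacuous T-partition system but no
    travel groupoid. *)
Lemma fibers_travel {V : Type} {G : graph V} {op} : [set: V] !=set0 ->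
  T_partition_system G (fibers op) -> travel_groupoid_on G op.
Proof.
move=> V0 TF.
have fixed u w : op u w = u <-> w = u.
  by have := T_P1a TF u => /seteqP[h1 h2]; split; [exact: h1 | exact: h2].
have edgeP u v : u <> v -> (op u v = v <-> edges G [set u; v]).
  exact: (T_P1b TF).
split; first split=> //.
(* (t1): the block of [u] indexed by [op u v] contains [v], so if [u] and [op u v] differ they are
   adjacent, and (P1b) applies to the edge read backwards. *)
- move=> u v; have [e|ne] := pselect (u = op u v).
    by rewrite -e; exact/fixed.
  apply/edgeP; first exact/nesym.
  by rewrite setUC; apply: (T_block_neighbor TF _ _ v).
(* (t2): if [u] and [op u v] differ, [v] lies in two blocks that (P2) makes disjoint. *)
- move=> u v e; have [ne|ne] := pselect (u = op u v).
    by apply/esym/fixed.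
  have : (fibers op u (op u v) `&` fibers op (op u v) u) v by [].
  by rewrite (T_P2 TF ne).
- apply/seteqP; split=> e /=.
    move=> eG; have [u [v [uv ee]]] := edgesP eG.
    by exists u, v; split=> //; apply/edgeP => //; rewrite -ee.
  by move=> [u [v [uv h ->]]]; apply/edgeP.
Qed.

Theorem theorem3p7 (V : Type) (V_neq0 : [set: V] !=set0) (G : graph V) :
  exists f : (V -> V -> V) -> (V -> V -> set V),
    set_bij [set op | travel_groupoid_on G op]
            [set F | T_partition_system G F] f.
Proof.
exists (@fibers V); split.
- by move=> op; exact: fibers_T_partition.
- by move=> op op' _ _; exact: fibers_inj.
- move=> F /= TF; have [op opF] := T_partition_fibers TF.
  by exists op => //=; apply: fibers_travel; rewrite ?opF.
Qed.
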